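(* For every multi-index $\mu$ and all $n,k\in\mathbb{N}$ one has $(\Delta^k s_{\mu})(n)=s_{\mu,\mu^*}(n,k)$.
   Context: $\mathbb{N}=\{0,1,2,\ldots\}$. A multi-index is a nonempty finite sequence $\mu=(\mu_1,\ldots,\mu_p)$ of positive integers; its length is $l(\mu)=p$ and its weight is $|\mu|=\mu_1+\cdots+\mu_p$. For $m\ge 1$ let $\mathcal{S}_m$ be the bijection from multi-indices of weight $m$ to subsets of $\{1,\ldots,m-1\}$ given by $\mathcal{S}_m(\mu_1,\ldots,\mu_p)=\{\mu_1+\cdots+\mu_k : 1\le k<p\}$. For $\mu$ of weight $m$, $\mu^*$ is the multi-index of weight $m$ with $\mathcal{S}_m(\mu^* )=\{1,\ldots,m-1\}\setminus\mathcal{S}_m(\mu)$. For $a\in\mathbb{C}^{\mathbb{N}}$, $(\Delta a)(n)=a(n)-a(n+1)$, and $\Delta^k$ is the $k$-fold composition of $\Delta$. For a multi-index $\mu=(\mu_1,\ldots,\mu_p)$ and $n\in\mathbb{N}$, $$s_{\mu}(n)=\sum_{0\le n_1\le\cdots\le n_p=n}\frac{1}{(n_1+1)^{\mu_1}\cdots(n_p+1)^{\mu_p}}.$$ For multi-indices $\mu=(\mu_1,\ldots,\mu_p)$, $\nu=(\nu_1,\ldots,\nu_q)$ of the same weight $m$ and $n,k\in\mathbb{N}$, $$s_{\mu,\nu}(n,k)=\binom{n+k}{n}^{-1}\sum_{\substack{0\le n_1\le\cdots\le n_p=n\\ 0\le k_1\le\cdots\le k_q=k}}\frac{1}{(n_{i_1}+k_{j_1}+1)\cdots(n_{i_m}+k_{j_m}+1)},$$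 where $(i_1,\ldots,i_m)=(\underbrace{1,\ldots,1}_{\mu_1},\ldots,\underbrace{p,\ldots,p}_{\mu_p})$ and $(j_1,\ldots,j_m)=(\underbrace{1,\ldots,1}_{\nu_1},\ldots,\underbrace{q,\ldots,q}_{\nu_q})$. *)

(* Defs.v *)
From mathcomp Require Import all_boot all_order all_algebra.
From mathcomp Require Import zify.

Set Implicit Arguments.
Unset Strict Implicit.
Unset Printing Implicit Defensive.

Import GRing.Theory.

(* The length of a multi-index mu is [size mu] and its weight is [sumn mu]. *)
Definition is_multi_index (mu : seq nat) : bool :=
  (mu != [::]) && all (leq 1) mu.

(* Subsets of {1, ..., m-1} are represented by those A : {set 'I_m} that do
   not contain 0. *)
Definition Sset (m : nat) (mu : seq nat) : {set 'I_m} :=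
  [set x : 'I_m | [exists k : 'I_(size mu),
                     (0 < k) && (x == sumn (take k mu) :> nat)]].

(* The inverse of [Sset m]: the successive gaps of 0 < x_1 < ... < x_r < m,
   where x_1 < ... < x_r are the elements of A. *)
Definition Sset_inv (m : nat) (A : {set 'I_m}) : seq nat :=
  pairmap (fun x y => y - x) 0 (rcons [seq val x | x <- enum A] m).

Definition dual (mu : seq nat) : seq nat :=
  let m := sumn mu in
  Sset_inv ([set x : 'I_m | 0 < x] :\: Sset m mu).

Section SsetBijection.

Let nth_scan mu k : k < size mu ->
  nth 0 (scanl addn 0 mu) k = sumn (take k.+1 mu).
Proof.
rewrite -[RHS]add0n; move: {2 3}0 => x.
elim: mu x k => [|a mu IH] x [|k] //= lt; first by rewrite take0 /= addn0.
by rewrite IH // addnA.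
Qed.

Let path_scan mu x : path ltn x (scanl addn x mu) = all (leq 1) mu.
Proof.
elim: mu x => [|a mu IH] x //=.
by rewrite IH -[X in X < _]addn0 ltn_add2l.
Qed.

Let scan_gaps x s : path leq x s ->
  scanl addn x (pairmap (fun a b => b - a) x s) = s.
Proof.
by elim: s x => [|y s IH] x //= /andP[le p]; rewrite subnKC // IH.
Qed.

Let enum_sorted m (A : {set 'I_m}) : sorted ltn [seq val x | x <- enum A].
Proof.
apply: (subseq_sorted ltn_trans (s2 := iota 0 m)); last exact: iota_ltn_sorted.
rewrite -val_enum_ord; apply: map_subseq.
have -> : enum A = filter (mem A) (enum 'I_m) by rewrite [in RHS]enumT.
exact: filter_subseq.
Qed.

Let path_cuts m (A : {set 'I_m}) : 0 < m -> A \subset [set x : 'I_m | 0 < x] ->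
  path ltn 0 (rcons [seq val x | x <- enum A] m).
Proof.
move=> m0 /subsetP A0.
rewrite (path_sortedE ltn_trans) all_rcons m0 /=; apply/andP; split.
  by apply/allP=> y /mapP[x]; rewrite mem_enum => /A0; rewrite inE => h ->.
have := enum_sorted A.
have : all (fun x => x < m) [seq val x | x <- enum A].
  by apply/allP=> _ /mapP[x _ ->] /=; exact: ltn_ord.
case: [seq val x | x <- enum A] => //= a s /andP[am sm] p.
rewrite rcons_path p /=.
by case: (lastP s) sm => [|s' y]; rewrite ?last_rcons ?all_rcons //= => /andP[].
Qed.

Lemma scan_Sset_inv m (A : {set 'I_m}) : 0 < m ->
  A \subset [set x : 'I_m | 0 < x] ->
  scanl addn 0 (Sset_inv A) = rcons [seq val x | x <- enum A] m.
Proof.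
move=> m0 A0; apply: scan_gaps.
by apply: sub_path (path_cuts m0 A0) => x y /=; exact: ltnW.
Qed.

Lemma Sset_sub m mu : is_multi_index mu ->
  Sset m mu \subset [set x : 'I_m | 0 < x].
Proof.
case/andP=> _ mu0; apply/subsetP=> x; rewrite !inE.
case/existsP=> [[k lk]] /= /andP[k0 /eqP ->].
case: k k0 lk => // k _ lk; case: mu mu0 lk => //= a mu /andP[a0 _] _.
by rewrite ltn_addr.
Qed.

Lemma Sset_inv_multi_index m (A : {set 'I_m}) : 0 < m ->
  A \subset [set x : 'I_m | 0 < x] -> is_multi_index (Sset_inv A).
Proof.
move=> m0 A0; apply/andP; split.
  by rewrite -size_eq0 size_pairmap size_rcons.
by rewrite -(path_scan _ 0) scan_Sset_inv // path_cuts.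
Qed.

Lemma sumn_Sset_inv m (A : {set 'I_m}) : 0 < m ->
  A \subset [set x : 'I_m | 0 < x] -> sumn (Sset_inv A) = m.
Proof.
move=> m0 A0; have sz : size (Sset_inv A) = (size (enum A)).+1.
  by rewrite size_pairmap size_rcons size_map.
have := @nth_scan (Sset_inv A) (size (enum A)).
rewrite sz ltnSn -sz take_size => /(_ isT) <-.
by rewrite scan_Sset_inv // nth_rcons size_map ltnn eqxx.
Qed.

Lemma Sset_invK m (A : {set 'I_m}) : 0 < m ->
  A \subset [set x : 'I_m | 0 < x] -> Sset m (Sset_inv A) = A.
Proof.
move=> m0 A0; have sz : size (Sset_inv A) = (size (enum A)).+1.
  by rewrite size_pairmap size_rcons size_map.
have nthE k : k < size (enum A) ->
    sumn (take k.+1 (Sset_inv A)) = nth 0 [seq val x | x <- enum A] k.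
  move=> lk; rewrite -nth_scan ?sz; last exact: ltnW.
  by rewrite scan_Sset_inv // nth_rcons size_map lk.
apply/setP=> x; rewrite inE; apply/existsP/idP => [[[k lk]]|xA].
  move=> /= /andP[]; case: k lk => // k; rewrite sz ltnS => lk _.
  rewrite nthE // (nth_map x) // => /eqP/val_inj ->.
  by rewrite -mem_enum mem_nth.
have xe : x \in enum A by rewrite mem_enum.
have lk : (index x (enum A)).+1 < size (Sset_inv A).
  by rewrite sz ltnS index_mem.
exists (Ordinal lk) => /=; rewrite nthE ?index_mem //.
by rewrite (nth_map x) ?index_mem // nth_index.
Qed.

Lemma SsetK mu : is_multi_index mu -> Sset_inv (Sset (sumn mu) mu) = mu.
Proof.
case/andP=> mu0 mu1; pose m := sumn mu.
suff E : rcons [seq val x | x <- enum (Sset m mu)] m = scanl addn 0 mu.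
  rewrite /Sset_inv -/m E; apply: scanlK => x y; exact: addKn.
have m0 : 0 < m.
  by rewrite /m; case: (mu) mu0 mu1 => //= a s _ /andP[a0 _]; rewrite ltn_addr.
have mi : is_multi_index mu by rewrite /is_multi_index mu0.
have p1 := path_cuts m0 (Sset_sub m mi).
have p2 : path ltn 0 (scanl addn 0 mu) by rewrite path_scan.
apply: (irr_sorted_eq ltn_trans ltnn (path_sorted p1) (path_sorted p2)) => x.
rewrite mem_rcons inE.
have lastE k : k.+1 = size mu -> nth 0 (scanl addn 0 mu) k = m.
  by move=> e; rewrite nth_scan -?e // e take_size.
apply/orP/(nthP 0) => [[/eqP -> | /mapP[y]]|[k]].
- exists (size mu).-1; last by apply: lastE; case: (mu) mu0.
  by rewrite size_scanl; case: (mu) mu0.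
- rewrite mem_enum inE => /existsP[[k lk]] /= /andP[k0 /eqP e] ->.
  case: k lk k0 e => // k lk _ ->; exists k; last by rewrite nth_scan // ltnW.
  by rewrite size_scanl ltnW.
rewrite size_scanl => lk xE.
have [e|ne] := eqVneq k.+1 (size mu); first by left; rewrite -xE lastE.
right; have lk' : k.+1 < size mu by rewrite ltn_neqAle ne.
have xm : x < m.
  rewrite -xE -(lastE (size mu).-1); last by case: (mu) mu0.
  apply: (sorted_ltn_nth ltn_trans 0 (path_sorted p2)); rewrite ?inE ?size_scanl; lia.
apply/mapP; exists (Ordinal xm) => //.
rewrite mem_enum inE; apply/existsP; exists (Ordinal lk') => /=.
by rewrite -nth_scan // xE.
Qed.

Lemma sumn_multi_index_gt0 mu : is_multi_index mu -> 0 < sumn mu.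
Proof.
by case/andP; case: mu => //= a s _ /andP[a0 _]; rewrite ltn_addr.
Qed.

Lemma dual_spec mu : is_multi_index mu ->
  [/\ is_multi_index (dual mu), sumn (dual mu) = sumn mu
    & Sset (sumn mu) (dual mu)
      = [set x : 'I_(sumn mu) | 0 < x] :\: Sset (sumn mu) mu].
Proof.
move=> mi; have m0 := sumn_multi_index_gt0 mi.
have sub := subsetDl [set x : 'I_(sumn mu) | 0 < x] (Sset (sumn mu) mu).
by split; [apply: Sset_inv_multi_index|apply: sumn_Sset_inv|apply: Sset_invK].
Qed.

End SsetBijection.

(* The sequence (1, ..., 1, ..., p, ..., p) with mu_i copies of i, where
   positions are numbered from 0, as [nth] does. *)
Definition blocks (mu : seq nat) : seq nat :=
  flatten [seq nseq (nth 0 mu i) i | i <- iota 0 (size mu)].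

(* 0 <= t_1 <= ... <= t_p = n, for p > 0 *)
Definition chain (n p : nat) (t : p.-tuple 'I_n.+1) : bool :=
  sorted leq [seq val x | x <- t] && (last ord0 t == n :> nat).

Local Open Scope ring_scope.

Definition Delta (V : zmodType) (a : nat -> V) : nat -> V :=
  fun n => a n - a n.+1.

Definition s_single (F : fieldType) (mu : seq nat) (n : nat) : F :=
  \sum_(t : (size mu).-tuple 'I_n.+1 | chain t)
    (\prod_(i < size mu) ((nth ord0 t i).+1%:R ^+ nth 0%N mu i))^-1.

Definition s_pair (F : fieldType) (mu nu : seq nat) (n k : nat) : F :=
  ('C(n + k, n)%:R)^-1 *
  \sum_(t : (size mu).-tuple 'I_n.+1 | chain t)
    \sum_(u : (size nu).-tuple 'I_k.+1 | chain u)
      (\prod_(r < sumn mu)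
         (nth ord0 t (nth 0%N (blocks mu) r)
            + nth ord0 u (nth 0%N (blocks nu) r) + 1)%N%:R)^-1.

(* Main.v *)
Require Import Defs.
From mathcomp Require Import all_boot all_order all_algebra.
From mathcomp Require Import reals complex.
From mathcomp Require Import zify ring.

Set Implicit Arguments.
Unset Strict Implicit.
Unset Printing Implicit Defensive.

Import Order.TTheory GRing.Theory Num.Theory.

(* For k = 0 only the zero chain contributes on the second side, and
   s_{mu,mu^*}(n,0) = s_mu(n). So it is enough that S = s_{mu,mu^*} satisfies
   S(n,k) = S(n+1,k) + S(n,k+1). This relation is symmetric in the two
   variables, and mu is built, together with mu^*, from ((1),(1)) by repeatedly
   increasing the last entry of one index while appending 1 to the other. Up to
   exchanging n and k, one such step replaces S by
   ((n+k+1) C(n+k,n))^-1 sum_{b <= k} C(n+b,n) S(n,b), and an Abel summation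
   shows that this operation preserves the relation. *)

(** * Complementary pairs of multi-indices *)

(* Each weight 0 < x < m is a cut of exactly one of the two indices; the last
   constructor makes the old weight a cut of the second one. *)
Inductive complementary : seq nat -> seq nat -> Prop :=
| Compl1 : complementary [:: 1] [:: 1]
| ComplSym mu nu : complementary mu nu -> complementary nu mu
| ComplRcons mu a nu : complementary (rcons mu a) nu ->
    complementary (rcons mu a.+1) (rcons nu 1).

Lemma is_multi_index_rcons mu a :
  is_multi_index (rcons mu a) = (0 < a) && all (leq 1) mu.
Proof.
by rewrite /is_multi_index all_rcons -size_eq0 size_rcons.
Qed.

Lemma complementary_multi_index mu nu : complementary mu nu ->
  is_multi_index mu && is_multi_index nu.
Proof.
elim=> {mu nu} [//|mu nu _|mu a nu _]; first by rewrite andbC.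
by rewrite !is_multi_index_rcons => /andP[/andP[_ ->] /andP[_ ->]].
Qed.

Lemma complementary_sumn mu nu : complementary mu nu -> sumn mu = sumn nu.
Proof.
elim=> {mu nu} [//|mu nu _ -> //|mu a nu _].
by rewrite !sumn_rcons => <-; lia.
Qed.

(** Induction on the weight. A last entry 1 following other entries is removed, and the last entry
    of the partner is increased; a last entry above 1 is decreased, and 1 is appended to the
    partner. *)
Lemma complementary_exists mu : is_multi_index mu ->
  exists nu, complementary mu nu.
Proof.
have [m] := ubnP (sumn mu); elim: m mu => // m IH mu.
case: (lastP mu) => [|s [|[|a]]] ltm; rewrite ?is_multi_index_rcons //=.
- move=> s0; case: (posnP (size s)) => [/size0nil ->|sz].
    by exists [:: 1]; exact: Compl1.
  have [||nu h] := IH s.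
  + by move: ltm; rewrite sumn_rcons addn1.
  + by rewrite /is_multi_index s0 -size_eq0 -lt0n sz.
  have /andP[_ nu0] := complementary_multi_index h.
  case: (lastP nu) nu0 h => // t b _ /ComplSym h.
  by exists (rcons t b.+1); apply/ComplSym/ComplRcons.
- move=> s0; have [||nu h] := IH (rcons s a.+1).
  + by move: ltm; rewrite !sumn_rcons; lia.
  + by rewrite is_multi_index_rcons.
  by exists (rcons nu 1); exact: ComplRcons.
Qed.

(** * Partial sums, and the partner as the dual *)

Lemma scanl_addn_sumn x s :
  scanl addn x s = [seq x + sumn (take k.+1 s) | k <- iota 0 (size s)].
Proof.
elim: s x => //= a s IH x; rewrite take0 /= addn0; congr (_ :: _).
rewrite IH -(addn0 1) iotaDl -map_comp; apply: eq_map => k /=.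
by rewrite addnA.
Qed.

(** The list of partial sums also contains the full weight, but [x] ranges below it, so only proper
    cuts remain. *)
Lemma mem_Sset mu (x : 'I_(sumn mu)) : is_multi_index mu ->
  (x \in Sset (sumn mu) mu) = (val x \in scanl addn 0 mu).
Proof.
move=> mi; rewrite inE scanl_addn_sumn.
apply/existsP/mapP => [[[k lk]] /= /andP[k0 /eqP e]|[k]].
  exists k.-1; last by rewrite prednK.
  by rewrite mem_iota; lia.
rewrite mem_iota add0n => /= lk e.
have [ek|nk] := eqVneq k.+1 (size mu).
  by move: (ltn_ord x); rewrite e ek take_size ltnn.
have lk' : k.+1 < size mu by rewrite ltn_neqAle nk.
by exists (Ordinal lk'); rewrite /= e.
Qed.

Lemma scanl_addn_rcons x s a :
  scanl addn x (rcons s a) = rcons (scanl addn x s) (x + sumn s + a).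
Proof.
by elim: s x => [|b s IH] x /=; rewrite ?addn0 // IH addnA.
Qed.

Lemma scanl_addn_le x s y : y \in scanl addn x s -> y <= x + sumn s.
Proof.
elim: s x => //= a s IH x; rewrite inE => /orP[/eqP -> |/IH]; lia.
Qed.

Lemma complementary_scanl mu nu x : complementary mu nu -> 0 < x < sumn mu ->
  (x \in scanl addn 0 mu) = (x \notin scanl addn 0 nu).
Proof.
move=> h; elim: h x => {mu nu} [x /=|mu nu h IH x xm|mu a nu h IH x].
- by lia.
- by rewrite IH ?negbK // (complementary_sumn h).
move: (complementary_sumn h) IH (complementary_multi_index h).
rewrite is_multi_index_rcons !sumn_rcons !scanl_addn_rcons !add0n.
move=> e IH /andP[/andP[a0 _] nu0] xm.
have := IH x; rewrite !mem_rcons !inE.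
have -> : x == sumn mu + a.+1 = false by lia.
have -> : x == sumn nu + 1 = false by lia.
(* The old weight is the only position not covered by induction: it exceeds every partial sum of
   [mu] because [a] is positive, and it is the last partial sum of [nu]. *)
have [xE _|xE ->] := eqVneq x (sumn mu + a); last by lia.
  have -> : x \in scanl addn 0 mu = false by apply/negP=> /scanl_addn_le; lia.
  case: (lastP nu) nu0 e => // t b _; rewrite sumn_rcons => e.
  rewrite scanl_addn_rcons mem_rcons inE.
  by have -> : x == 0 + sumn t + b by lia.
by [].
Qed.

(** The partner and [dual mu] have the same weight and the same cuts, so [SsetK] identifies them. *)
Lemma complementary_dual mu : is_multi_index mu -> complementary mu (dual mu).
Proof.
move=> mi; have [nu h] := complementary_exists mi.
have [dmi dsum dS] := dual_spec mi.
have /andP[_ nmi] := complementary_multi_index h.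
have nsum := complementary_sumn h.
suff -> : dual mu = nu by [].
rewrite -(SsetK dmi) -(SsetK nmi) dsum -nsum dS; congr Sset_inv.
apply/setP=> x; rewrite in_setD [in X in _ && X]inE.
have [x0|x0] := ltnP 0 x; last first.
  rewrite andbF; apply/esym/negbTE/negP => /(subsetP (Sset_sub _ nmi)).
  by rewrite inE ltnNge x0.
rewrite mem_Sset //.
have -> : (x \in Sset (sumn mu) nu) = (val x \in scanl addn 0 nu).
  by move: x x0; rewrite nsum => x _; rewrite mem_Sset.
by rewrite andbT (complementary_scanl h) ?negbK ?x0 //=.
Qed.

(** * Chains and the removal of their last entry *)

(** Plain sequences of naturals are used because removing the last entry changes the endpoint, hence
    the ordinal type of the entries. *)
Definition chains (p n : nat) : seq (seq nat) :=
  [seq map val (val t) | t : p.-tuple 'I_n.+1 in [pred t | chain t]].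

Lemma mem_chains p n c :
  (c \in chains p n) = [&& size c == p, sorted leq c & last 0 c == n].
Proof.
apply/imageP/and3P => [[t tc ->]|[/eqP sc srt /eqP lst]].
  case/andP: tc => s l; rewrite size_map size_tuple; split=> //.
  by rewrite (last_map val _ ord0).
have cn : all (fun x => x < n.+1) c.
  case: (lastP c) srt lst => // s x; rewrite last_rcons => srt <-.
  rewrite all_rcons ltnSn /=; move: srt.
  by rewrite (sorted_pairwise leq_trans) pairwise_rcons => /andP[].
have st : size (map inord c : seq 'I_n.+1) == p by rewrite size_map sc.
have e : c = map val (Tuple st).
  rewrite /= -map_comp map_id_in // => x /(allP cn) xn /=.
  by rewrite inordK.
exists (Tuple st) => //; apply/andP; rewrite -e srt; split=> //.
by apply/eqP; rewrite -[RHS]lst [in RHS]e (last_map val _ ord0).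
Qed.

Lemma uniq_chains p n : uniq (chains p n).
Proof.
by rewrite map_inj_uniq ?enum_uniq // => t u /(inj_map val_inj) /val_inj.
Qed.

Lemma chains1 n : chains 1 n = [:: [:: n]].
Proof.
apply: perm_small_eq => //; apply: uniq_perm; rewrite ?uniq_chains // => c.
rewrite mem_chains inE; case: c => [|x [|y c]] //=.
  by rewrite eqseq_cons andbT.
by rewrite eqseq_cons andbF.
Qed.

Lemma chains_rcons p n : perm_eq (chains p.+2 n)
  [seq rcons c n | b <- iota 0 n.+1, c <- chains p.+1 b].
Proof.
apply: uniq_perm; first exact: uniq_chains.
  apply: allpairs_uniq_dep => [|b _|]; rewrite ?iota_uniq ?uniq_chains //.
  (* The endpoint of the shortened chain is recovered as its last entry. *)
  move=> [a c] [b d] /allpairsPdep[a' [c' [_ h [-> ->]]]].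
  move=> /allpairsPdep[b' [d' [_ h' [-> ->]]]] /= /rcons_inj[e].
  by move: h h'; rewrite !mem_chains e => /and3P[_ _ /eqP <-] /and3P[_ _ /eqP <-].
move=> c; rewrite mem_chains; apply/and3P/allpairsPdep => [[]|[b [d [bn]]]].
  case: (lastP c) => // d x; rewrite size_rcons last_rcons eqSS => sd + /eqP xn.
  rewrite xn; case: d sd => // a d sd /=; rewrite rcons_path => /andP[srt le].
  exists (last 0 (a :: d)), (a :: d); split=> //; rewrite ?mem_iota ?mem_chains //.
    by rewrite -[0 :: _]/(iota 0 n.+1) mem_iota.
  by rewrite sd /= srt eqxx.
rewrite mem_chains => /and3P[sd srt /eqP ld] ->.
rewrite size_rcons last_rcons; split=> //.
case: d sd srt ld => //= a d _ srt ld; rewrite rcons_path srt ld /=.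
by move: bn; rewrite mem_iota.
Qed.

Local Open Scope ring_scope.

Lemma sum_chains (F : fieldType) p n (f : seq nat -> F) :
  \sum_(t : p.-tuple 'I_n.+1 | chain t) f (map val t) =
  \sum_(c <- chains p n) f c.
Proof. by rewrite /chains /image_mem big_map big_enum. Qed.

Lemma sum_chains_rcons (F : fieldType) p n (f : seq nat -> F) :
  \sum_(c <- chains p.+2 n) f c =
  \sum_(b < n.+1) \sum_(c <- chains p.+1 b) f (rcons c n).
Proof.
rewrite (perm_big _ (chains_rcons p n)) big_allpairs_dep.
rewrite -(big_mkord xpredT (fun b => \sum_(c <- chains p.+1 b) f (rcons c n))).
by rewrite /index_iota subn0.
Qed.

Lemma nth_val n (s : seq 'I_n.+1) i :
  nth 0%N (map val s) i = nth ord0 s i.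
Proof.
have [lt|le] := ltnP i (size s); first by rewrite (nth_map ord0).
by rewrite !nth_default // size_map.
Qed.

(** * Sums over pairs of chains *)

Section Pascal.
Variable F : numFieldType.

(* Additive form of Delta (f^~ k) = f^~ k.+1, visibly symmetric in n and k. *)
Definition pascal (f : nat -> nat -> F) :=
  forall n k, f n k = f n.+1 k + f n k.+1.

Definition pair_weight (m : nat) (I J c d : seq nat) : F :=
  (\prod_(r < m) (nth 0%N c (nth 0%N I r) + nth 0%N d (nth 0%N J r) + 1)%N%:R)^-1.

Lemma s_pairE mu nu n k : s_pair F mu nu n k = ('C(n + k, n)%:R)^-1 *
  \sum_(c <- chains (size mu) n) \sum_(d <- chains (size nu) k)
     pair_weight (sumn mu) (blocks mu) (blocks nu) c d.
Proof.
rewrite /s_pair -sum_chains; congr (_ * _); apply: eq_bigr => t _.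
rewrite -sum_chains; apply: eq_bigr => u _; congr (_^-1); apply: eq_bigr => r _.
by rewrite !nth_val.
Qed.

Lemma s_pair_sym mu nu n k : sumn mu = sumn nu ->
  s_pair F mu nu n k = s_pair F nu mu k n.
Proof.
move=> e; rewrite !s_pairE exchange_big.
have -> : 'C(n + k, n) = 'C(k + n, k).
  by rewrite -bin_sub ?leq_addr // addKn addnC.
congr (_ * _); apply: eq_bigr => c _; apply: eq_bigr => d _.
rewrite /pair_weight e; congr (_^-1); apply: eq_bigr => r _.
by rewrite [(_ + nth _ c _)%N]addnC.
Qed.

Lemma size_blocks mu : size (blocks mu) = sumn mu.
Proof.
rewrite /blocks size_flatten /shape -map_comp; congr sumn.
by apply/(eq_from_nth (x0 := 0%N)); rewrite ?size_map ?size_iota // => i lt;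
  rewrite (nth_map 0%N) ?size_iota //= size_nseq nth_iota.
Qed.

Lemma blocks_rcons mu a : blocks (rcons mu a) = blocks mu ++ nseq a (size mu).
Proof.
rewrite /blocks size_rcons -addn1 iotaD map_cat flatten_cat /= cats0 nth_rcons.
rewrite ltnn eqxx; congr (flatten _ ++ _); apply/eq_in_map => i.
by rewrite mem_iota nth_rcons => /= ->.
Qed.

Lemma mem_blocks mu i : i \in blocks mu -> (i < size mu)%N.
Proof.
by case/flattenP=> s /mapP[j]; rewrite mem_iota => /= lj -> /nseqP[->].
Qed.

Lemma blocks_rconsS mu a :
  blocks (rcons mu a.+1) = rcons (blocks (rcons mu a)) (size mu).
Proof. by rewrite !blocks_rcons -addn1 nseqD catA cats1. Qed.

(** * Abel summation and the step operator *)

(** In the induction on [k], the relation for [f] merges the two new terms on the left into a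
    multiple of [f n k.+1], and Pascal's rule splits its coefficient. *)
Lemma pascal_sum f n k : pascal f ->
  \sum_(b < k.+1) 'C(n.+1 + b, n.+1)%:R * f n.+1 b
  + 'C(n + k.+1, n.+1)%:R * f n k.+1
  = \sum_(b < k.+1) 'C(n + b, n)%:R * f n b.
Proof.
move=> pf; elim: k => [|k IH].
  by rewrite !big_ord1 !addn0 !binn addn1 binn !mul1r -pf.
rewrite big_ord_recr [RHS]big_ord_recr -IH /= addSnnS.
rewrite -!addrA -mulrDr -pf; congr (_ + _).
by rewrite [(n + k.+2)%N]addnS binS natrD mulrDl.
Qed.

Lemma pascal_step f : pascal f ->
  pascal (fun n k => ('C(n + k, n)%:R * (n + k + 1)%N%:R)^-1 *
    \sum_(b < k.+1) 'C(n + b, n)%:R * f n b).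
Proof.
move=> pf n k.
(* [E1] and [E2] express both neighbouring binomials as rational multiples of ['C(n + k, n)]. Since
   [pascal_sum] eliminates [V], only a field identity in [W] and [x] is left. *)
have E1 := mul_bin_diag (n + k).+1 n.
have E2 : (k.+1 * 'C(n + k.+1, n) = (n + k.+1) * 'C(n + k, n))%N.
  by have := mul_bin_down (n + k.+1) n; rewrite addKn addnS => <-.
have := pascal_sum n k pf.
rewrite /= [in X in _ = _ + X]big_ord_recr /=.
set V := \sum_(b < k.+1) 'C(n + b, n)%:R * f n b.
set W := \sum_(b < k.+1) _; set x := f n k.+1 => <-.
have c0 : 'C(n + k, n)%:R != 0 :> F.
  by rewrite pnatr_eq0 -lt0n bin_gt0 leq_addr.
have N0 : n.+1%:R != 0 :> F by rewrite pnatr_eq0.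
have K0 : k.+1%:R != 0 :> F by rewrite pnatr_eq0.
move: E1 E2 => /(congr1 (fun i => i%:R : F)) + /(congr1 (fun i => i%:R : F)).
rewrite !natrM /= addSn addnS => E1 E2.
have {}E1 : 'C((n + k).+1, n.+1)%:R
    = (n + k).+1%:R * 'C(n + k, n)%:R / n.+1%:R :> F.
  by rewrite E1 mulrC mulKf.
have {}E2 : 'C((n + k).+1, n)%:R
    = (n + k).+1%:R * 'C(n + k, n)%:R / k.+1%:R :> F.
  by rewrite -E2 mulrC mulKf.
rewrite E1 E2; move: c0 N0 K0; set c := 'C(_, _)%:R => c0.
have M0 : (n + k).+1%:R != 0 :> F by rewrite pnatr_eq0.
have L0 : (n + k).+2%:R != 0 :> F by rewrite pnatr_eq0.
move: M0 L0; rewrite !addn1 -![_.+2%:R]natr1 -![_.+1%:R]natr1 !natrD.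
move: (n%:R) (k%:R) => a b M0 L0 N0 K0.
by field; do ?[apply/andP; split].
Qed.

(** * The recursion for complementary pairs and its initial value *)

(** The one new factor sits at the ends of both chains and equals [n + k + 1]. The other factors see
    the second chain without its last entry, which ends at some [b <= k]; ['C(n + b, n)] undoes the
    normalisation of the inner sum. *)
Lemma s_pair_rcons mu a nu n k : (0 < size nu)%N ->
  sumn (rcons mu a) = sumn nu ->
  s_pair F (rcons mu a.+1) (rcons nu 1) n k =
  ('C(n + k, n)%:R * (n + k + 1)%N%:R)^-1 *
    \sum_(b < k.+1) 'C(n + b, n)%:R * s_pair F (rcons mu a) nu n b.
Proof.
move=> nu0 e; rewrite s_pairE !size_rcons invfM -mulrA; congr (_ * _).
rewrite -(prednK nu0).
under eq_bigr do rewrite sum_chains_rcons.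
rewrite exchange_big /= !mulr_sumr; apply: eq_bigr => b _.
rewrite s_pairE mulVKf ?pnatr_eq0 -?lt0n ?bin_gt0 ?leq_addr //.
rewrite size_rcons (prednK nu0) !mulr_sumr big_seq [RHS]big_seq.
apply: eq_bigr => c; rewrite mem_chains => /and3P[/eqP sc _ /eqP lc].
rewrite !mulr_sumr big_seq [RHS]big_seq.
apply: eq_bigr => d; rewrite mem_chains => /and3P[/eqP sd _ /eqP ld].
rewrite -invfM mulrC; congr (_^-1).
have -> : sumn (rcons mu a.+1) = (sumn (rcons mu a)).+1.
  by rewrite !sumn_rcons addnS.
rewrite blocks_rconsS (blocks_rconsS nu 0) big_ord_recr /=.
(* The appended 1 was read as an increased entry 0, whose block is empty. *)
have -> : blocks (rcons nu 0) = blocks nu by rewrite blocks_rcons cats0.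
rewrite !(nth_rcons _ (blocks _)) !size_blocks -e ltnn eqxx.
rewrite nth_rcons sd ltnn eqxx.
rewrite -[size mu]/((size mu).+1.-1) -sc nth_last lc; congr (_ * _).
apply: eq_bigr => r _; rewrite !nth_rcons !size_blocks -e ltn_ord.
(* Old block indices stay below [size nu], so they never reach the appended entry. *)
by rewrite sd mem_blocks // mem_nth // size_blocks -e.
Qed.

Lemma s_pair_complementary mu nu : complementary mu nu -> pascal (s_pair F mu nu).
Proof.
elim=> {mu nu} [|mu nu h IH|mu a nu h IH] n k.
  (* s_{(1),(1)} is the image under the step of the indicator of k = 0. *)
- have d0 : pascal (fun _ k => (k == 0%N)%:R : F).
    by move=> _ [|j]; rewrite /= addr0.
  have E i j : s_pair F [:: 1%N] [:: 1%N] i j =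
      ('C(i + j, i)%:R * (i + j + 1)%N%:R)^-1 *
      \sum_(b < j.+1) 'C(i + b, i)%:R * (val b == 0%N)%:R.
    rewrite s_pairE !chains1 !big_seq1 big_ord_recl /= !addn0 binn mulr1 big1.
      by rewrite addr0 mulr1 invfM /pair_weight big_ord1.
    by move=> b _; rewrite mulr0.
  by rewrite !E; exact: (pascal_step d0).
(* Exchanging the variables swaps the two terms on the right of the relation. *)
- by rewrite !(s_pair_sym _ _ (esym (complementary_sumn h))) IH addrC.
have /andP[_ /andP[nu0 _]] := complementary_multi_index h.
rewrite -size_eq0 -lt0n in nu0.
rewrite !(s_pair_rcons _ _ nu0 (complementary_sumn h)).
exact: pascal_step.
Qed.

Lemma s_pair_0r mu nu n : nu != [::] -> s_pair F mu nu n 0 = s_single F mu n.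
Proof.
move=> nu0; rewrite /s_pair addn0 binn invr1 mul1r.
apply: eq_bigr => t _.
have e (u : seq 'I_1) i : nth ord0 u i = ord0 by rewrite [LHS]ord1.
rewrite (big_pred1 [tuple ord0 | i < size nu]) /= => [|u].
  congr (_^-1).
  under eq_bigr do rewrite e addn0 addn1.
  (* Grouping the factors by blocks turns the product over the weight into a product of powers. *)
  pose g i : F := (nth ord0 t i).+1%:R.
  rewrite -size_blocks -(big_mkord xpredT (fun r => g (nth 0%N (blocks mu) r))).
  rewrite -(big_nth 0%N xpredT g).
  rewrite big_flatten big_map /= -{1}[size mu]subn0 -/(index_iota 0 _) big_mkord.
  by apply: eq_bigr => i _; rewrite big_nseq iter_mulr_1.
rewrite /chain [last _ _]ord1 eqxx andbT /=.
have -> : u == [tuple ord0 | i < size nu].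
  by apply/eqP/eq_from_tnth => i; rewrite !ord1.
case: (val u) => //= a s; elim: s a => //= b s IH a.
by rewrite IH (ord1 a).
Qed.

End Pascal.

Theorem theorem3p8 (R : realType) (mu : seq nat) (hmu : is_multi_index mu)
    (n k : nat) :
  iter k (@Delta (complex R)) (s_single (complex R) mu) n
  = s_pair (complex R) mu (dual mu) n k.
Proof.
have h := complementary_dual hmu.
elim: k n => [|k IH] n /=.
  rewrite s_pair_0r //.
  by have /andP[_ /andP[]] := complementary_multi_index h.
by rewrite /Delta !IH (s_pair_complementary _ h n k) addrAC subrr add0r.
Qed.
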